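(* Let $\rho>0$ and let $(w_t)_{t\ge 0}$ be the exact gradient-ascent iterates under the fixed distribution $d_0$, started at $w_0$: $$w_{t+1}=w_t+\rho\,g_{\mathrm{RL}}^w(w_t),\qquad g_{\mathrm{RL}}^w(w):=\mathbb{E}_{(x,y)\sim d_0}\big[R(x,y)\,s^w_w(x,y)\big].$$ Then for any integer $T\ge 1$, $$\|\Pi(w_T-w_0)\|_2\;\le\;\rho\,\varepsilon_0\sum_{t=0}^{T-1}\sqrt{\ \|\Pi\,\Sigma_{\mathrm{succ}}^w(w_t)\,\Pi\|_{\mathrm{op}}\ }.$$
   Context: Log-linear policy: prompts $x\sim\mu$; for each $x$ a finite response set $\mathcal{Y}(x)$; a representation $z_w(x,y)\in\mathbb{R}^d$, differentiable in $w\in\mathbb{R}^p$; a head $b\in\mathbb{R}^d$; inverse temperature $\tau>0$; for $\theta=(b,w)$, $$\pi_\theta(y\mid x)=\frac{\exp(\tau\, b^\top z_w(x,y))}{\sum_{y'\in\mathcal{Y}(x)}\exp(\tau\, b^\top z_w(x,y'))}.$$ Fix an initialization $\theta_0=(b_0,w_0)$ and the frozen rollout distribution $d_0(x,y):=\mu(x)\pi_{\theta_0}(y\mid x)$; all expectations defining the updates are taken under this same $d_0$ for all steps considered. The reward is binary, $R(x,y)=\mathbf{1}\{\mathrm{pass}(x,y)\}$ for some event $\mathrm{pass}$, and $\varepsilon_0:=\Pr_{(x,y)\sim d_0}(\mathrm{pass}(x,y)=1)>0$. The representation score (with head fixed at $b_0$) is $s^w_w(x,y):=\nabla_w\log\pi_{(b_0,w)}(y\mid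 x)\in\mathbb{R}^p$, and $$\Sigma_{\mathrm{succ}}^w(w):=\mathbb{E}_{(x,y)\sim d_0}\big[s^w_w(x,y)s^w_w(x,y)^\top\mid\mathrm{pass}(x,y)=1\big]\in\mathbb{R}^{p\times p},$$ assumed finite at every $w$ considered. Let $\eta>0$. With $\lambda_1\ge\dots\ge\lambda_p\ge0$ the eigenvalues and $v_1,\dots,v_p$ an orthonormal eigenbasis of $\Sigma_{\mathrm{succ}}^w(w_0)$, let $S_{\mathrm{low}}(\eta):=\mathrm{span}\{v_i:\lambda_i<\eta\}$ and let $\Pi$ be the orthogonal projector of $\mathbb{R}^p$ onto $S_{\mathrm{low}}(\eta)$. $\|\cdot\|_{\mathrm{op}}$ is the spectral norm. *)

(* Defs.v *)
From HB Require Import structures.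
From mathcomp Require Import all_boot all_order all_algebra finmap.
From mathcomp Require Import all_classical all_reals all_analysis.
From mathcomp Require Import measurable_realfun.

Set Implicit Arguments.
Unset Strict Implicit.
Unset Printing Implicit Defensive.

Import Order.TTheory GRing.Theory Num.Theory.
Import numFieldNormedType.Exports.

Local Open Scope classical_set_scope.
Local Open Scope ring_scope.

Section euclidean.
Context {R : realType} {n : nat}.
Implicit Types (u v : 'cV[R]_n) (A P : 'M[R]_n).

Definition dotv u v : R := (u^T *m v) 0 0.

(* The library norm `|u| on matrices is the sup norm, hence this one. *)
Definition norm2 u : R := Num.sqrt (dotv u u).

Definition opnorm A : R :=
  sup [set norm2 (A *m u) | u in [set u | norm2 u <= 1]].

Definition is_orth_projector (S : {vspace 'cV[R]_n}) P : Prop :=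
  forall u, P *m u \in S /\ (forall s, s \in S -> dotv (u - P *m u) s = 0).

Definition sorted_eigenbasis A (lam : 'I_n -> R) (v : 'I_n -> 'cV[R]_n) :
    Prop :=
  [/\ forall i j : 'I_n, (i <= j)%N -> lam j <= lam i,
      forall i, 0 <= lam i,
      forall i, A *m v i = lam i *: v i &
      forall i j, dotv (v i) (v j) = (i == j)%:R].

Definition low_space (lam : 'I_n -> R) (v : 'I_n -> 'cV[R]_n) (eta : R) :
    {vspace 'cV[R]_n} :=
  <<[seq v i | i <- enum 'I_n & lam i < eta]>>%VS.

Definition gradient (f : 'cV[R]_n -> R) (w : 'cV[R]_n) : 'cV[R]_n :=
  \col_i 'D_(delta_mx i 0) f w.

End euclidean.

(* E_P[f | A] for an event A of positive probability *)
Definition cond_expectation d (T : measurableType d) (R : realType)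
    (P : probability T R) (A : set T) (f : T -> R) : R :=
  fine (\int[P]_(z in A) (f z)%:E) / fine (P A).

(* The prompt and response spaces are arbitrary measurable spaces; the two     *)
(* measurability fields give a meaning to the expectations under the rollout   *)
(* distribution and hold automatically when both spaces are discrete and       *)
(* countable. The field [measurable_resp] says that the counting measure on    *)
(* the finite set [resp x] is a kernel in x.                                   *)
Record log_linear_policy (R : realType) (dX dY : measure_display)
    (X : measurableType dX) (Y : measurableType dY) (k p : nat) :=
  LogLinearPolicy {
    resp : X -> {fset Y} ;
    rep : 'cV[R]_p -> X -> Y -> 'cV[R]_k ;
    temp : R ;
    temp_gt0 : 0 < temp ;
    resp_neq0 : forall x, resp x != fset0 ;
    differentiable_rep : forall x y w,
      differentiable (fun w' => rep w' x y) w ;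
    measurable_resp : forall U : set Y, measurable U ->
      measurable_fun [set: X] (fun x => \sum_(y <- resp x) \1_U y : R) ;
    measurable_rep : forall w i,
      measurable_fun [set: X * Y] (fun z => rep w z.1 z.2 i 0) }.

Section policy.
Context {R : realType} {dX dY : measure_display}.
Context {X : measurableType dX} {Y : measurableType dY} {k p : nat}.
Variable M : log_linear_policy R X Y k p.
Implicit Types (b : 'cV[R]_k) (w : 'cV[R]_p).

Definition weight b w x y : R := expR (temp M * dotv b (rep M w x y)).

(* Only the values at y \in resp M x matter. *)
Definition policy b w x y : R :=
  weight b w x y / \sum_(y' <- resp M x) weight b w x y'.

Definition score b w (z : X * Y) : 'cV[R]_p :=
  gradient (fun w' => ln (policy b w' z.1 z.2)) w.

End policy.


Section rollout.
Context {R : realType} {dX dY : measure_display}.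
Context {X : measurableType dX} {Y : measurableType dY} {k p : nat}.
Variable M : log_linear_policy R X Y k p.
Local Open Scope ereal_scope.

Section counting_kernel.

Definition resp_count (x : X) (U : set Y) : \bar R :=
  (\sum_(y <- resp M x) \1_U y)%R%:E.

Let resp_count0 x : resp_count x set0 = 0.
Proof. by rewrite /resp_count big1// => y _; rewrite indic0. Qed.

Let resp_count_ge0 x U : 0 <= resp_count x U.
Proof. by rewrite lee_fin sumr_ge0. Qed.

Let resp_count_sigma_additive x : semi_sigma_additive (resp_count x).
Proof.
move=> F mF tF mUF; rewrite /resp_count -sumEFin.
rewrite [X in X @ _ --> _](_ : _ = fun n =>
    \sum_(y <- resp M x) \sum_(0 <= i < n) (\1_(F i) y)%:E); last first.
  by apply/funext => n; rewrite exchange_big/=; apply: eq_bigr => i _;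
    rewrite sumEFin.
apply: cvg_nnesum => y _.
  by apply: nearW => n; apply: sume_ge0 => i _; rewrite lee_fin.
exact: (@measure_semi_sigma_additive _ _ _
  (dirac y : {measure set Y -> \bar R}) F mF tF mUF).
Qed.

HB.instance Definition _ x := isMeasure.Build _ _ _ (resp_count x)
  (resp_count0 x) (resp_count_ge0 x) (@resp_count_sigma_additive x).

Lemma integral_resp_count x (f : Y -> R) : (forall y, (0 <= f y)%R) ->
    measurable_fun [set: Y] f ->
  \int[resp_count x]_y (f y)%:E = (\sum_(y <- resp M x) f y)%R%:E.
Proof.
move=> f0 /measurable_EFinP mf.
pose m (n : nat) : {measure set Y -> \bar R} := dirac (nth point (resp M x) n).
have -> : \int[resp_count x]_y (f y)%:E =
    \int[msum m (size (resp M x))]_y (f y)%:E.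
  apply: eq_measure_integral => A mA _.
  by rewrite /= /resp_count /msum -sumEFin (big_nth point) big_mkord.
rewrite ge0_integral_measure_sum//; first last.
  by move=> y _; rewrite lee_fin.
rewrite -sumEFin (big_nth point) big_mkord; apply: eq_bigr => i _.
by rewrite integral_dirac// diracT mul1e.
Qed.

Lemma measurable_card_resp :
  measurable_fun [set: X] (fun x => (size (resp M x))%:R : R).
Proof.
rewrite [X in measurable_fun _ X](_ : _ =
    (fun x => \sum_(y <- resp M x) \1_[set: Y] y : R)%R).
  exact: measurable_resp.
apply/funext => x; under eq_bigr do rewrite indicT.
by rewrite big_const_seq count_predT iter_addr_0.
Qed.

Variable N : nat.

(* truncation to a finite kernel, for measurable_fun_integral_finite_kernel *)
Definition resp_count_le (x : X) : {measure set Y -> \bar R} :=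
  if (size (resp M x) <= N)%N
  then (resp_count x : {measure set Y -> \bar R}) else mzero.

Let measurable_resp_count_le U :
  measurable U -> measurable_fun [set: X] (resp_count_le ^~ U).
Proof.
move=> mU; rewrite [X in measurable_fun _ X](_ : _ = fun x =>
    if (size (resp M x) <= N)%N then resp_count x U else 0); last first.
  by apply/funext => x; rewrite /resp_count_le; case: ifPn.
apply: measurable_fun_ifT => //.
  rewrite [X in measurable_fun _ X](_ : _ =
      fun x => ((size (resp M x))%:R <= (N%:R : R))%R).
    by apply: measurable_fun_ler => //; exact: measurable_card_resp.
  by apply/funext => x; rewrite ler_nat.
by apply/measurable_EFinP; exact: measurable_resp.
Qed.

HB.instance Definition _ := isKernel.Build _ _ _ _ _ resp_count_le
  measurable_resp_count_le.

Let resp_count_le_uub : measure_fam_uub resp_count_le.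
Proof.
exists N.+1%:R%R => x; rewrite /resp_count_le; case: ifPn => [xN|_].
  rewrite /= /resp_count; under eq_bigr do rewrite indicT.
  by rewrite big_const_seq count_predT iter_addr_0 lte_fin ltr_nat ltnS.
by rewrite /mzero lte_fin.
Qed.

HB.instance Definition _ := @Kernel_isFinite.Build _ _ _ _ _ resp_count_le
  resp_count_le_uub.

Lemma measurable_sum_resp_le (f : X * Y -> R) : (forall z, (0 <= f z)%R) ->
    measurable_fun [set: X * Y] f ->
  measurable_fun [set: X] (fun x =>
    if (size (resp M x) <= N)%N
    then (\sum_(y <- resp M x) f (x, y))%R%:E else 0).
Proof.
move=> f0 mf.
rewrite [X in measurable_fun _ X](_ : _ =
    fun x => \int[resp_count_le x]_y (EFin \o f) (x, y)).
  apply: measurable_fun_integral_finite_kernel => /=.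
    by move=> z; rewrite lee_fin.
  exact/measurable_EFinP.
apply/funext => x; rewrite /resp_count_le; case: ifPn => _ /=.
  by rewrite integral_resp_count//; exact: measurable_fun_pair2.
by rewrite integral_measure_zero.
Qed.

End counting_kernel.

Lemma measurable_sum_resp (f : X * Y -> R) : (forall z, (0 <= f z)%R) ->
    measurable_fun [set: X * Y] f ->
  measurable_fun [set: X] (fun x => (\sum_(y <- resp M x) f (x, y))%R).
Proof.
move=> f0 mf; apply/measurable_EFinP.
apply: (emeasurable_fun_cvg (fun N x => if (size (resp M x) <= N)%N
    then (\sum_(y <- resp M x) f (x, y))%R%:E else 0)).
  by move=> N; exact: measurable_sum_resp_le.
move=> x _; apply: cvg_near_cst; exists (size (resp M x)) => // n /= xn.
by rewrite xn.
Qed.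

Variables (b : 'cV[R]_k) (w : 'cV[R]_p).

Lemma measurable_weight :
  measurable_fun [set: X * Y] (fun z => weight M b w z.1 z.2).
Proof.
apply: measurableT_comp => //; apply: measurable_funM => //.
rewrite [X in measurable_fun _ X](_ : _ = fun z =>
    (\sum_i b i 0 * rep M w z.1 z.2 i 0)%R); last first.
  by apply/funext => z; rewrite /dotv mxE; apply: eq_bigr => i _; rewrite mxE.
apply: measurable_sum => i; apply: measurable_funM => //.
exact: measurable_rep.
Qed.

Lemma weight_gt0 x y : (0 < weight M b w x y)%R.
Proof. exact: expR_gt0. Qed.

Lemma policy_ge0 x y : (0 <= policy M b w x y)%R.
Proof.
by rewrite divr_ge0 ?(ltW (weight_gt0 _ _))// sumr_ge0// => ? _;
  rewrite ltW ?weight_gt0.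
Qed.

Lemma sum_weight_gt0 x : (0 < \sum_(y <- resp M x) weight M b w x y)%R.
Proof.
have /fset0Pn[y xy] := resp_neq0 M x.
rewrite (big_rem y)//= ltr_pwDl ?weight_gt0// sumr_ge0// => ? _.
by rewrite ltW ?weight_gt0.
Qed.

Lemma sum_policy x : (\sum_(y <- resp M x) policy M b w x y = 1)%R.
Proof. by rewrite -mulr_suml divff// gt_eqF ?sum_weight_gt0. Qed.

Lemma measurable_policy :
  measurable_fun [set: X * Y] (fun z => policy M b w z.1 z.2).
Proof.
apply: measurable_funM; first exact: measurable_weight.
have ms : measurable_fun [set: X]
    (fun x => \sum_(y <- resp M x) weight M b w x y)%R.
  apply: (@measurable_sum_resp (fun z => weight M b w z.1 z.2)).
    by move=> z; rewrite ltW ?weight_gt0.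
  exact: measurable_weight.
rewrite [X in measurable_fun _ X](_ : _ = fun z : X * Y =>
    ((\sum_(y <- resp M z.1) weight M b w z.1 y) `^ (- 1))%R); last first.
  by apply/funext => z; rewrite powR_inv1// ltW ?sum_weight_gt0.
apply: (@measurableT_comp _ _ _ _ _ _ (fun r : R => (r `^ (- 1))%R)) => //.
exact: (measurableT_comp ms (@measurable_fst _ _ X Y)).
Qed.

Variable mu : probability X R.

(* The joint law mu(dx) policy(y | x) of a prompt and a sampled response. *)
Definition rollout (A : set (X * Y)) : \bar R :=
  \int[mu]_x (\sum_(y <- resp M x) policy M b w x y * \1_A (x, y))%R%:E.

Let mterm A : measurable A -> measurable_fun [set: X] (fun x =>
  (\sum_(y <- resp M x) policy M b w x y * \1_A (x, y))%R).
Proof.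
move=> mA.
apply: (@measurable_sum_resp (fun z => policy M b w z.1 z.2 * \1_A z)%R).
  by move=> z; rewrite mulr_ge0 ?policy_ge0.
by apply: measurable_funM; [exact: measurable_policy|exact: measurable_indic].
Qed.

Let rollout0 : rollout set0 = 0.
Proof.
by apply: integral0_eq => x _; rewrite big1// => y _; rewrite indic0 mulr0.
Qed.

Let term_ge0 A x :
  (0 <= \sum_(y <- resp M x) policy M b w x y * \1_A (x, y))%R.
Proof. by apply: sumr_ge0 => y _; rewrite mulr_ge0 ?policy_ge0. Qed.

Let rollout_ge0 A : 0 <= rollout A.
Proof. by apply: integral_ge0 => x _; rewrite lee_fin. Qed.

Let rollout_sigma_additive : semi_sigma_additive rollout.
Proof.
move=> F mF tF mUF.
suff -> : rollout (\bigcup_n F n) = \sum_(0 <= i <oo) rollout (F i).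
  by apply: is_cvg_nneseries => n _ _; exact: rollout_ge0.
rewrite /rollout -integral_nneseries//.
- apply: eq_integral => x _; rewrite -sumEFin.
  under [in RHS]eq_eseriesr do rewrite -sumEFin.
  rewrite nneseries_sum.
    apply: eq_bigr => y _; rewrite EFinM indic_bigcup//.
    under [in RHS]eq_eseriesr do rewrite EFinM.
    rewrite nneseriesZl// => n _; by rewrite lee_fin.
  by move=> y n _; rewrite lee_fin mulr_ge0 ?policy_ge0.
- by move=> n; apply/measurable_EFinP; exact: mterm.
- by move=> n x _; rewrite lee_fin.
Qed.

HB.instance Definition _ := isMeasure.Build _ _ _ rollout
  rollout0 rollout_ge0 rollout_sigma_additive.

Let rolloutT : rollout setT = 1.
Proof.
rewrite /rollout; under eq_integral => x _.
  under eq_bigr do rewrite indicT mulr1.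
  rewrite sum_policy; over.
by rewrite integral_cst// mul1e; exact: probability_setT.
Qed.

HB.instance Definition _ := Measure_isProbability.Build _ _ _ rollout rolloutT.

Definition rollout_prob : probability (X * Y)%type R := rollout.

End rollout.

Section updates.
Context {R : realType} {dX dY : measure_display}.
Context {X : measurableType dX} {Y : measurableType dY} {k p : nat}.
Variables (M : log_linear_policy R X Y k p) (mu : probability X R).
Variables (b0 : 'cV[R]_k) (w0 : 'cV[R]_p) (pass : set (X * Y)).

Local Notation d0 := (rollout_prob M b0 w0 mu).

Definition success_rate : R := fine (d0 pass).

Definition success_cov_finite (w : 'cV[R]_p) : Prop :=
  forall i j, d0.-integrable pass
    (fun z => ((score M b0 w z *m (score M b0 w z)^T) i j)%:E).

Definition success_cov (w : 'cV[R]_p) : 'M[R]_p :=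
  \matrix_(i, j) cond_expectation d0 pass
    (fun z => (score M b0 w z *m (score M b0 w z)^T) i j).

Definition grad_RL (w : 'cV[R]_p) : 'cV[R]_p :=
  \col_i fine ('E_d0[fun z => (\1_pass z * score M b0 w z i 0)%R])%E.

Definition ascent_iterate (rho : R) (t : nat) : 'cV[R]_p :=
  iter t (fun w => w + rho *: grad_RL w) w0.

End updates.

(* Main.v *)
(* With g = grad_RL w and a = Pi g, self-adjointness of Pi gives             *)
(*   |a|^2 = a^T g = E[1_pass a^T s] <= eps0 sqrt(a^T Sigma(w) a)              *)
(* by Cauchy-Schwarz on the event pass, and a = Pi a bounds a^T Sigma(w) a by  *)
(* |Pi Sigma(w) Pi| |a|^2, so |Pi g| <= eps0 sqrt |Pi Sigma(w) Pi|; sum over   *)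
(* the iterates. Only the second moments of the score are assumed finite; its  *)
(* own integrability needs its measurability in (x, y), which holds because a  *)
(* derivative is a limit of a sequence of difference quotients.                *)

Require Import Defs.
From HB Require Import structures.
From mathcomp Require Import all_boot all_order all_algebra finmap.
From mathcomp Require Import all_classical all_reals all_analysis.
From mathcomp Require Import measurable_realfun.
From mathcomp Require Import ring lra.

Set Implicit Arguments.
Unset Strict Implicit.
Unset Printing Implicit Defensive.

Import Order.TTheory GRing.Theory Num.Theory.
Import numFieldNormedType.Exports.

Local Open Scope classical_set_scope.
Local Open Scope ring_scope.

(** The displacement is [rho] times a sum of gradients ([ascent_iterate_sub]), so a bound on each
    projected gradient suffices. A direction in which successful responses have small score variance
    receives little gradient, because only successes contribute to it ([grad_RLE]) and a mean is at
    most the root of a second moment ([Rintegral_sqr_le], hence [dotv_grad_RL_le]). Testing the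
    gradient against its own projection turns this directional bound into a norm bound
    ([norm2_projection_le]). *)

(** * Euclidean geometry of column vectors, operator norm and orthogonal projectors *)

Section euclidean_geometry.
Context {R : realType} {n : nat}.
Implicit Types (u v w : 'cV[R]_n) (A P : 'M[R]_n) (S : {vspace 'cV[R]_n}).

Lemma dotvE u v : dotv u v = \sum_i u i 0 * v i 0.
Proof. by rewrite /dotv mxE; apply: eq_bigr => i _; rewrite mxE. Qed.

Lemma outer_productE u v i j : (u *m v^T) i j = u i 0 * v j 0.
Proof. by rewrite mxE big_ord1 mxE. Qed.

Lemma dotvC u v : dotv u v = dotv v u.
Proof. by rewrite !dotvE; apply: eq_bigr => i _; rewrite mulrC. Qed.

Lemma dotvDr u v w : dotv u (v + w) = dotv u v + dotv u w.
Proof. by rewrite /dotv mulmxDr mxE. Qed.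

Lemma dotvZr (c : R) u v : dotv u (c *: v) = c * dotv u v.
Proof. by rewrite /dotv -scalemxAr mxE. Qed.

Lemma dotvBr u v w : dotv u (v - w) = dotv u v - dotv u w.
Proof. by rewrite -scaleN1r dotvDr dotvZr mulN1r. Qed.

Lemma dotvBl u v w : dotv (u - v) w = dotv u w - dotv v w.
Proof. by rewrite dotvC dotvBr !(dotvC w). Qed.

Lemma dotvZl (c : R) u v : dotv (c *: u) v = c * dotv u v.
Proof. by rewrite dotvC dotvZr dotvC. Qed.

Lemma dotv0r u : dotv u 0 = 0.
Proof. by rewrite -(scale0r 0) dotvZr mul0r. Qed.

Lemma dotv_sumr I (r : seq I) u (F : I -> 'cV[R]_n) :
  dotv u (\sum_(i <- r) F i) = \sum_(i <- r) dotv u (F i).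
Proof.
by elim/big_ind2: _ => [|x a y b <- <-|//]; rewrite ?dotv0r ?dotvDr.
Qed.

Lemma dotvv_ge0 u : 0 <= dotv u u.
Proof. by rewrite dotvE sumr_ge0// => i _; rewrite -expr2 sqr_ge0. Qed.

Lemma dotvv_eq0 u : (dotv u u == 0) = (u == 0).
Proof.
apply/idP/eqP => [|->]; last by rewrite dotv0r.
rewrite dotvE psumr_eq0 => [/allP u0|i _]; last by rewrite -expr2 sqr_ge0.
apply/matrixP => i j; rewrite ord1 mxE.
by have := u0 i (mem_index_enum i); rewrite /= mulf_eq0 orbb => /eqP.
Qed.

Lemma norm2_ge0 u : 0 <= norm2 u.
Proof. exact: sqrtr_ge0. Qed.

Lemma sqr_norm2 u : norm2 u ^+ 2 = dotv u u.
Proof. by rewrite sqr_sqrtr ?dotvv_ge0. Qed.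

Lemma norm2_eq0 u : (norm2 u == 0) = (u == 0).
Proof. by rewrite -dotvv_eq0 -sqr_norm2 sqrf_eq0. Qed.

Lemma norm2Z (c : R) u : norm2 (c *: u) = `|c| * norm2 u.
Proof.
by rewrite /norm2 dotvZr dotvZl mulrA -expr2 sqrtrM ?sqr_ge0// sqrtr_sqr.
Qed.

(** Cauchy-Schwarz: with [a = norm2 u] and [b = norm2 v], the squared norm of [b *: u - a *: v] is
    [2ab(ab - dotv u v)], and it is nonnegative. *)
Lemma dotv_le_norm2 u v : dotv u v <= norm2 u * norm2 v.
Proof.
have [->|u0] := eqVneq u 0.
  by rewrite dotvC dotv0r mulr_ge0 ?norm2_ge0.
have [->|v0] := eqVneq v 0; first by rewrite dotv0r mulr_ge0 ?norm2_ge0.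
have nu : 0 < norm2 u by rewrite lt_def norm2_eq0 u0 norm2_ge0.
have nv : 0 < norm2 v by rewrite lt_def norm2_eq0 v0 norm2_ge0.
have := dotvv_ge0 (norm2 v *: u - norm2 u *: v).
rewrite !dotvBr !dotvBl !dotvZl !dotvZr (dotvC v u) -!sqr_norm2 => h.
have {h} : 0 <= 2 * (norm2 u * norm2 v) * (norm2 u * norm2 v - dotv u v) by lra.
by rewrite pmulr_rge0 ?subr_ge0// !mulr_gt0.
Qed.

(** Pair the sum [x] with itself: its squared norm is the sum of the [dotv x (F i)], each at most
    [norm2 x * norm2 (F i)]; then cancel [norm2 x]. *)
Lemma norm2_sum_le I (r : seq I) (F : I -> 'cV[R]_n) :
  norm2 (\sum_(i <- r) F i) <= \sum_(i <- r) norm2 (F i).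
Proof.
set x := \sum_(i <- r) F i.
have [->|x0] := eqVneq x 0.
  by rewrite /norm2 dotv0r sqrtr0 sumr_ge0// => i _; exact: sqrtr_ge0.
have nx : 0 < norm2 x by rewrite lt_def norm2_eq0 x0 norm2_ge0.
rewrite -(ler_pM2l nx) -expr2 sqr_norm2 {2}/x dotv_sumr mulr_sumr.
by apply: ler_sum => i _; exact: dotv_le_norm2.
Qed.

Lemma coord_le_norm2 u i : `|u i 0| <= norm2 u.
Proof.
rewrite -sqrtr_sqr ler_wsqrtr// dotvE (bigD1 i)//= -expr2 lerDl.
by rewrite sumr_ge0// => j _; rewrite -expr2 sqr_ge0.
Qed.

(** Needed because [sup] is a genuine supremum only on bounded sets. The coordinates of [u] are at
    most 1 in absolute value, so each entry of [A *m u] is bounded by the l1 norm of a row of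
    [A]. *)
Lemma opnorm_has_ubound A :
  has_ubound [set norm2 (A *m u) | u in [set u | norm2 u <= 1]].
Proof.
exists (Num.sqrt (\sum_i (\sum_j `|A i j|) ^+ 2)) => _ [u /= u1 <-].
rewrite ler_wsqrtr// dotvE; apply: ler_sum => i _.
rewrite -expr2 -real_normK ?num_real// lerXn2r ?nnegrE ?sumr_ge0// mxE.
apply: le_trans (ler_norm_sum _ _ _) _; apply: ler_sum => j _.
by rewrite normrM ler_piMr// (le_trans (coord_le_norm2 u j)).
Qed.

Lemma norm2_mulmx_le A u : norm2 (A *m u) <= opnorm A * norm2 u.
Proof.
have [->|u0] := eqVneq u 0.
  by rewrite mulmx0 /norm2 dotv0r sqrtr0 mulr0.
have nu : 0 < norm2 u by rewrite lt_def norm2_eq0 u0 norm2_ge0.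
rewrite -ler_pdivrMr// mulrC -(gtr0_norm (_ : 0 < (norm2 u)^-1)) ?invr_gt0//.
rewrite -norm2Z scalemxAr; apply: ub_le_sup; first exact: opnorm_has_ubound.
by exists ((norm2 u)^-1 *: u) => //=; rewrite norm2Z gtr0_norm ?invr_gt0//
  mulVf ?gt_eqF.
Qed.

(** The residual [u - P *m u] lies in [S] and is orthogonal to [S], hence to itself. *)
Lemma orth_projector_id S P u : is_orth_projector S P -> u \in S -> P *m u = u.
Proof.
move=> PS uS; have [PuS orth] := PS u.
apply/esym/eqP; rewrite -subr_eq0 -dotvv_eq0 orth//.
by rewrite rpredB.
Qed.

Lemma orth_projector_dotv S P u s : is_orth_projector S P -> s \in S ->
  dotv s (P *m u) = dotv s u.
Proof.
move=> PS sS; have [_ /(_ _ sS)] := PS u.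
by rewrite dotvBl !(dotvC _ s) => /eqP; rewrite subr_eq0 => /eqP.
Qed.

(* With [a = P *m g], the left-hand side is [a^T A a = a^T (P A P) a], since  *)
(* [P] fixes [a].                                                              *)
Lemma dotv_compression_le S P A g : is_orth_projector S P ->
  dotv (P *m g) (A *m (P *m g)) <= opnorm (P *m A *m P) * norm2 (P *m g) ^+ 2.
Proof.
move=> PS; have [aS _] := PS g; move: (P *m g) aS => a aS.
rewrite -(orth_projector_dotv _ PS aS) -[X in A *m X](orth_projector_id PS aS).
rewrite !mulmxA expr2 mulrCA; apply: le_trans (dotv_le_norm2 _ _) _.
by rewrite ler_wpM2l ?norm2_ge0 ?norm2_mulmx_le.
Qed.

(** With [a = P *m g], [dotv a g] is the squared norm of [a], while [dotv_compression_le] bounds the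
    right-hand side by [c * Num.sqrt (opnorm (P *m A *m P)) * norm2 a]; cancel one factor
    [norm2 a]. *)
Lemma norm2_projection_le S P A g (c : R) : is_orth_projector S P -> 0 <= c ->
  dotv (P *m g) g <= c * Num.sqrt (dotv (P *m g) (A *m (P *m g))) ->
  norm2 (P *m g) <= c * Num.sqrt (opnorm (P *m A *m P)).
Proof.
move=> PS c0; have [aS _] := PS g.
rewrite -(orth_projector_dotv _ PS aS) -sqr_norm2 => h.
have [->|a0] := eqVneq (P *m g) 0.
  by rewrite /norm2 dotv0r sqrtr0 mulr_ge0 ?sqrtr_ge0.
have na : 0 < norm2 (P *m g) by rewrite lt_def norm2_eq0 a0 norm2_ge0.
rewrite -(ler_pM2r na) -expr2; apply: le_trans h _.
rewrite -mulrA ler_wpM2l// mulrC -[X in X * _](ger0_norm (norm2_ge0 _)).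
rewrite -sqrtr_sqr -sqrtrM ?sqr_ge0// mulrC ler_wsqrtr//.
exact: (dotv_compression_le A g PS).
Qed.
End euclidean_geometry.

(** * First and second moments on a finite measure space *)

Section second_moments.
Local Open Scope ereal_scope.
Context d (T : measurableType d) (R : realType).
Variables (mu : {finite_measure set T -> \bar R}) (A : set T).
Hypothesis mA : measurable A.
Implicit Types f g : T -> R.

Lemma Rintegral_sum I (r : seq I) (F : I -> T -> R) :
    (forall i, mu.-integrable A (EFin \o F i)) ->
  (\int[mu]_(x in A) (\sum_(i <- r) F i x) =
   \sum_(i <- r) \int[mu]_(x in A) F i x)%R.
Proof.
move=> iF; rewrite /Rintegral.
under eq_integral do rewrite -sumEFin.
rewrite integral_sum// sum_fine// => i _.
exact: (integrable_fin_num mA (iF i)).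
Qed.

Lemma integrable_sumr I (r : seq I) (F : I -> T -> R) :
    (forall i, mu.-integrable A (EFin \o F i)) ->
  mu.-integrable A (EFin \o (fun x => \sum_(i <- r) F i x)%R).
Proof.
move=> iF; apply: eq_integrable (integrable_sum mA r (fun i _ => iF i)) => //.
by move=> x _; rewrite /= sumEFin.
Qed.

(** Domination by [1 + f ^+ 2], whose constant part is integrable since [mu] is finite. *)
Lemma integrable_sqr f : measurable_fun A f ->
    mu.-integrable A (EFin \o (fun x => f x * f x)%R) ->
  mu.-integrable A (EFin \o f).
Proof.
move=> mf if2.
have i1 := finite_measure_integrable_cst mu 1%R mA.
apply: le_integrable (integrableD mA i1 if2) => //; first exact/measurable_EFinP.
move=> x _ /=; rewrite lee_fin.
have f20 : (0 <= f x * f x)%R by rewrite -expr2 sqr_ge0.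
rewrite [leRHS]ger0_norm ?addr_ge0//.
have ff : (f x * f x = `|f x| ^+ 2)%R by rewrite real_normK ?num_real.
have := sqr_ge0 (`|f x| - 1); rewrite ff in f20 *; nra.
Qed.

(** Cauchy-Schwarz against the constant 1, obtained by integrating [(f - c) ^+ 2 >= 0] for every
    constant [c] and then choosing [c]. *)
Lemma Rintegral_sqr_le f :
    mu.-integrable A (EFin \o f) ->
    mu.-integrable A (EFin \o (fun x => f x * f x)%R) ->
  ((\int[mu]_(x in A) f x) ^+ 2 <=
   fine (mu A) * \int[mu]_(x in A) (f x * f x))%R.
Proof.
move=> if1 if2.
set I := (\int[mu]_(x in A) f x)%R; set J := (\int[mu]_(x in A) (f x * f x))%R.
set m := fine (mu A).
have H (c : R) : (2 * c * I - c ^+ 2 * m <= J)%R.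
  have iZ : mu.-integrable A (EFin \o (fun x => 2 * c * f x)%R).
    exact: (integrableZl mA (2 * c)%R if1).
  have iC := finite_measure_integrable_cst mu (c ^+ 2)%R mA.
  rewrite -RintegralZl// -Rintegral_cst//= -RintegralB//.
  apply: le_Rintegral => //.
    exact: (integrableB mA iZ iC).
  by move=> x _ /=; have := sqr_ge0 (f x - c); nra.
have m0 : (0 <= m)%R by rewrite fine_ge0.
(* If [m = 0], the bound [H] is linear in [c], which forces [I = 0]: otherwise the chosen [c] would
   give [J + 1 <= J]. *)
have [m00|mn0] := eqVneq m 0%R.
  have := H ((J + 1) / (2 * I))%R; rewrite m00 mulr0 subr0.
  have [->|I0] := eqVneq I 0%R; first by rewrite expr0n/= mul0r.
  rewrite (_ : 2 * _ * I = J + 1)%R; last by field.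
  lra.
(* This [c], the mean of [f], maximises the left-hand side of [H], with value [I ^+ 2 / m]. *)
have := H (I / m)%R.
rewrite (_ : 2 * _ * I - _ = I ^+ 2 / m)%R; last by field.
by rewrite ler_pdivrMr 1?mulrC// lt_def mn0.
Qed.

End second_moments.

(** * Differentiability in the parameter and measurability of the score *)

Section score_measurability.
Context {R : realType}.

(** Pointwise limit of measurable difference quotients along the steps [1 / (m + 1)]. It reduces
    measurability of the score to that of the policy at each fixed parameter. *)
Lemma measurable_derive {V : normedModType R} d (T : measurableType d)
    (F : V -> T -> R) (a v : V) :
    (forall w, measurable_fun [set: T] (F w)) ->
    (forall x, derivable (F ^~ x) a v) ->
  measurable_fun [set: T] (fun x => 'D_v (F ^~ x) a).
Proof.
move=> mF dF.
pose h (m : nat) : R := m.+1%:R^-1.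
apply: (@measurable_fun_cvg _ _ _ _ (fun m x =>
    (h m)^-1 * (F (h m *: v + a) x - F a x))) => //.
  move=> m; apply: measurable_funM => //; apply: measurable_funB; exact: mF.
move=> x _.
have /cvgr_dnbhsP/(_ h) := dF x; apply; split=> [m|].
  by rewrite invr_eq0 pnatr_eq0.
exact: cvg_harmonic.
Qed.

Context {dX dY : measure_display}.
Context {X : measurableType dX} {Y : measurableType dY} {k p : nat}.
Variable M : log_linear_policy R X Y k p.

Lemma differentiable_weight b x y w :
  differentiable (fun w' => weight M b w' x y) w.
Proof.
apply: (@differentiable_comp _ _ _ _
  (fun w' => temp M * dotv b (rep M w' x y)) expR).
  apply: (@differentiableZ _ _ _ (fun w' => dotv b (rep M w' x y))).
  rewrite [X in differentiable X _](_ : _ =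
      \sum_i (fun w' => b i 0 * rep M w' x y i 0)); last first.
    apply/funext => w'; rewrite fct_sumE /dotv mxE.
    by apply: eq_bigr => i _; rewrite mxE.
  apply: differentiable_sum => i.
  apply: (@differentiableZ _ _ _ (fun w' => rep M w' x y i 0)).
  apply: (@differentiable_comp _ _ _ _ (fun w' => rep M w' x y)
    (fun N : 'cV[R]_k => N i 0)).
    exact: differentiable_rep.
  exact: differentiable_coord.
apply/derivable1_diffP; exact: derivable_expR.
Qed.

Lemma differentiable_sum_weight b x w :
  differentiable (fun w' => \sum_(y <- resp M x) weight M b w' x y) w.
Proof.
elim: (resp M x : seq Y) => [|y s ih].
  under eq_fun do rewrite big_nil.
  exact: differentiable_cst.
under eq_fun do rewrite big_cons.
by apply: differentiableD => //; exact: differentiable_weight.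
Qed.

(** The quotient [policy] is positive for every [y], even outside [resp M x], so [ln] is
    differentiable there and the score can be treated on the whole product space. *)
Lemma differentiable_ln_policy b x y w :
  differentiable (fun w' => ln (policy M b w' x y)) w.
Proof.
have sgt := sum_weight_gt0 M b w x.
apply: (@differentiable_comp _ _ _ _ (fun w' => policy M b w' x y) (@ln R)).
  apply: differentiableM; first exact: differentiable_weight.
  apply: differentiableV; first exact: differentiable_sum_weight.
  by rewrite gt_eqF.
apply/derivable1_diffP; apply: ex_derive; apply: is_derive1_ln.
by rewrite divr_gt0 ?weight_gt0.
Qed.
End score_measurability.

(** * The policy gradient against the success covariance *)

Section success_gradient.
Context {R : realType} {dX dY : measure_display}.
Context {X : measurableType dX} {Y : measurableType dY} {k p : nat}.
Variables (M : log_linear_policy R X Y k p) (mu : probability X R).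
Variables (b0 : 'cV[R]_k) (w0 : 'cV[R]_p) (pass : set (X * Y)).

Local Notation d0 := (rollout_prob M b0 w0 mu).

Lemma measurable_score b w i :
  measurable_fun [set: X * Y] (fun z => score M b w z i 0).
Proof.
under eq_fun do rewrite mxE.
apply: (measurable_derive (F := fun w' (z : X * Y) =>
    ln (policy M b w' z.1 z.2))) => [w'|z].
  apply: measurableT_comp; first exact: measurable_ln.
  exact: measurable_policy.
by apply: diff_derivable; exact: differentiable_ln_policy.
Qed.

(** The binary reward becomes the domain of integration, the same event on which the covariance is
    taken. *)
Lemma grad_RLE w i :
  grad_RL M mu b0 w0 pass w i 0 = \int[d0]_(z in pass) score M b0 w z i 0.
Proof.
rewrite mxE unlock Rintegral_mkcond patch_indic.
by under eq_fun do rewrite mulrC.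
Qed.

Hypothesis mpass : measurable pass.
Variable w : 'cV[R]_p.
Hypothesis covfin : success_cov_finite M mu b0 w0 pass w.

Let s i (z : X * Y) : R := score M b0 w z i 0.

Let integrable_score2 i j :
  d0.-integrable pass (EFin \o (fun z => s i z * s j z)).
Proof.
apply: eq_integrable (covfin i j) => // z _.
by rewrite /= outer_productE.
Qed.

(** The diagonal entries in [covfin] provide square integrability. *)
Let integrable_score i : d0.-integrable pass (EFin \o s i).
Proof.
apply: integrable_sqr => //.
by apply: measurable_funTS; exact: measurable_score.
Qed.

Let success_covE i j : success_rate M mu b0 w0 pass != 0 ->
  success_rate M mu b0 w0 pass * success_cov M mu b0 w0 pass w i j =
  \int[d0]_(z in pass) (s i z * s j z).
Proof.
move=> e0; rewrite mxE /cond_expectation mulrC divfK//.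
by apply: congr1; apply: eq_integral => z _; rewrite outer_productE.
Qed.

(** [Rintegral_sqr_le] applied to [f], the score in direction [a]. The success rate enters twice, as
    the mass of [pass] and as the normalisation of [success_cov], so it leaves the square root with
    exponent one. *)
Lemma dotv_grad_RL_le (a : 'cV[R]_p) : 0 < success_rate M mu b0 w0 pass ->
  dotv a (grad_RL M mu b0 w0 pass w) <= success_rate M mu b0 w0 pass *
    Num.sqrt (dotv a (success_cov M mu b0 w0 pass w *m a)).
Proof.
set e := success_rate _ _ _ _ _ => e0.
pose f z := \sum_i a i 0 * s i z.
have iZ i : d0.-integrable pass (EFin \o (fun z => a i 0 * s i z)).
  exact: (integrableZl mpass (a i 0) (integrable_score i)).
have iZ2 ij : d0.-integrable pass
    (EFin \o (fun z => a ij.1 0 * a ij.2 0 * (s ij.1 z * s ij.2 z))).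
  exact: (integrableZl mpass _ (integrable_score2 ij.1 ij.2)).
(* Written as one sum over pairs, the square can be integrated term by term with a single use of
   [Rintegral_sum]. *)
have f2E : (fun z => f z * f z) = (fun z =>
    \sum_(ij : 'I_p * 'I_p) a ij.1 0 * a ij.2 0 * (s ij.1 z * s ij.2 z)).
  apply/funext => z; rewrite /f mulr_suml.
  rewrite -(pair_bigA _ (fun i j => a i 0 * a j 0 * (s i z * s j z)))/=.
  apply: eq_bigr => i _; rewrite mulr_sumr; apply: eq_bigr => j _.
  by rewrite mulrACA.
have If : \int[d0]_(z in pass) f z = dotv a (grad_RL M mu b0 w0 pass w).
  rewrite Rintegral_sum// dotvE; apply: eq_bigr => i _.
  by rewrite grad_RLE RintegralZl.
have If2 : \int[d0]_(z in pass) (f z * f z) =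
    e * dotv a (success_cov M mu b0 w0 pass w *m a).
  rewrite f2E Rintegral_sum// dotvE mulr_sumr.
  rewrite -(pair_bigA _ (fun i j =>
    \int[d0]_(z in pass) (a i 0 * a j 0 * (s i z * s j z))))/=.
  apply: eq_bigr => i _; rewrite mxE !mulr_sumr; apply: eq_bigr => j _.
  rewrite RintegralZl// -success_covE ?gt_eqF// -/e; ring.
have if1 : d0.-integrable pass (EFin \o f) by exact: integrable_sumr.
have if2 : d0.-integrable pass (EFin \o (fun z => f z * f z)).
  by rewrite f2E; exact: integrable_sumr.
have := Rintegral_sqr_le mpass if1 if2.
rewrite If If2 -/e mulrA -expr2 => h.
apply: le_trans (ler_norm _) _.
rewrite -(ger0_norm (ltW e0)) -!sqrtr_sqr -sqrtrM ?sqr_ge0//.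
by rewrite ler_wsqrtr.
Qed.

End success_gradient.

(** * Summation along the iterates *)

Lemma ascent_iterate_sub {R : realType} {dX dY : measure_display}
    {X : measurableType dX} {Y : measurableType dY} {k p : nat}
    (M : log_linear_policy R X Y k p) (mu : probability X R)
    (b0 : 'cV[R]_k) (w0 : 'cV[R]_p) (pass : set (X * Y)) (rho : R) (T : nat) :
  ascent_iterate M mu b0 w0 pass rho T - w0 = rho *: \sum_(0 <= t < T)
    grad_RL M mu b0 w0 pass (ascent_iterate M mu b0 w0 pass rho t).
Proof.
elim: T => [|T ih]; first by rewrite big_nil scaler0 subrr.
by rewrite big_nat_recr//= scalerDr -ih addrAC.
Qed.

Theorem theoremC1 (R : realType) (dX dY : measure_display)
    (X : measurableType dX) (Y : measurableType dY) (k p : nat)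
    (M : log_linear_policy R X Y k p) (mu : probability X R)
    (b0 : 'cV[R]_k) (w0 : 'cV[R]_p) (pass : set (X * Y)) (eta rho : R)
    (lam : 'I_p -> R) (v : 'I_p -> 'cV[R]_p) (Pi : 'M[R]_p) (T : nat) :
  let eps0 := success_rate M mu b0 w0 pass in
  let w := ascent_iterate M mu b0 w0 pass rho in
  let Sigma := success_cov M mu b0 w0 pass in
  measurable pass ->
  0 < eps0 ->
  0 < eta ->
  0 < rho ->
  (1 <= T)%N ->
  (forall t, (t < T)%N -> success_cov_finite M mu b0 w0 pass (w t)) ->
  sorted_eigenbasis (Sigma w0) lam v ->
  is_orth_projector (low_space lam v eta) Pi ->
  norm2 (Pi *m (w T - w0)) <=
    rho * eps0 * \sum_(0 <= t < T) Num.sqrt (opnorm (Pi *m Sigma (w t) *m Pi)).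
Proof.
move=> eps0 w Sigma mpass e0 _ rho0 _ covfin _ PS.
rewrite ascent_iterate_sub -scalemxAr norm2Z (gtr0_norm rho0) -mulrA.
rewrite ler_pM2l// mulmx_sumr mulr_sumr.
apply: le_trans (norm2_sum_le _ _) _.
rewrite !big_mkord; apply: ler_sum => t _.
(* Here [c] is [eps0], [A] is [Sigma (w t)] and [g] is the gradient at [w t]; the remaining premise
   is [dotv_grad_RL_le] in the direction [Pi *m g]. *)
apply: (norm2_projection_le PS); first exact: ltW.
by apply: dotv_grad_RL_le => //; exact: covfin.
Qed.
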